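(* Let $k\ge 2$ be an integer and, for $j\ge 1$, let $\lambda^{(j)}$ be the largest zero of $G_j(x)$. Then $\bigcup_{j=1}^{\infty}(\lambda^{(j)},\lambda^{(j+1)}]=(0,2\sqrt{k-1})$. Moreover, if an integer $t\ge 4$ and a real number $\theta$ satisfy $\lambda^{(t-3)}<\theta\le\lambda^{(t-2)}$, then $$b(k,\theta)\le M(k,t,c)=2\left(\sum_{i=0}^{t-4}(k-1)^i+\frac{(k-1)^{t-3}}{c}+\frac{(k-1)^{t-2}}{c}\right),$$ where $c=-F_{t-2}(\theta)/G_{t-4}(\theta)$.
   Context: Graphs are finite and simple. $b(k,\theta)$ denotes the maximum order (number of vertices) of a connected bipartite $k$-regular graph $\Gamma$ with $\lambda_2(\Gamma)\le\theta$, where $\lambda_2(\Gamma)$ is the second largest eigenvalue of the adjacency matrix of $\Gamma$ (counted with multiplicity). For the integer $k\ge 2$ define polynomials $F_i(x)$ by $F_0(x)=1$, $F_1(x)=x$, $F_2(x)=x^2-k$, and $F_i(x)=xF_{i-1}(x)-(k-1)F_{i-2}(x)$ for $i\ge 3$; and $G_i(x)=\sum_{j=0}^{\lfloor i/2\rfloor}F_{i-2j}(x)$ for $i\ge 0$. *)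

(* Defs.v *)
From HB Require Import structures.
From mathcomp Require Import all_boot all_order all_algebra.
From mathcomp Require Import polyrcf.

Set Implicit Arguments.
Unset Strict Implicit.
Unset Printing Implicit Defensive.

Import Order.TTheory GRing.Theory Num.Theory.

Local Open Scope ring_scope.

Record sgraph := SGraph {
  vertex :> finType;
  adj : rel vertex;
  adj_sym : symmetric adj;
  adj_irr : irreflexive adj }.

Definition order (G : sgraph) : nat := #|G|.

Definition connected (G : sgraph) : Prop :=
  (0 < #|G|)%N /\ forall x y : G, connect (@adj G) x y.

Definition bipartite (G : sgraph) : Prop :=
  exists A : {set G}, forall x y : G, adj x y -> (x \in A) != (y \in A).

Definition regular (k : nat) (G : sgraph) : Prop :=
  forall x : G, #|[set y : G | adj x y]| = k.

(* The real zeros of p in nondecreasing order, repeated with multiplicity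
   (the empty sequence when p = 0). *)
Definition real_zeros (R : rcfType) (p : {poly R}) : seq R :=
  flatten [seq nseq (mup x p) x | x <- rootsR p].

(* Equal to 0 by convention if p has no real zero; this never happens for the
   polynomials G_j, j >= 1, below, all of whose complex zeros are real. *)
Definition largest_zero (R : rcfType) (p : {poly R}) : R :=
  last 0 (real_zeros p).

Definition adjmx (R : rcfType) (G : sgraph) : 'M[R]_#|G| :=
  \matrix_(i, j) (adj (enum_val i) (enum_val j))%:R.

(* The adjacency matrix is real symmetric, so its characteristic polynomial
   splits over R and real_zeros lists the whole spectrum; the default value 0
   is only reached for graphs of order at most 1. *)
Definition lambda2 (R : rcfType) (G : sgraph) : R :=
  (rev (real_zeros (char_poly (adjmx R G))))`_1.

Definition b_class (R : rcfType) (k : nat) (theta : R) (G : sgraph) : Prop :=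
  [/\ connected G, bipartite G, regular k G & lambda2 R G <= theta].

(* is_b k theta n means b(k, theta) = n. The maximum is a relation rather than
   a total function because, for a general theta, the class may be empty or
   contain graphs of arbitrarily large order. *)
Definition is_b (R : rcfType) (k : nat) (theta : R) (n : nat) : Prop :=
  (exists G : sgraph, b_class k theta G /\ order G = n) /\
  (forall G : sgraph, b_class k theta G -> (order G <= n)%N).

Fixpoint Fpoly (R : nzRingType) (k i : nat) : {poly R} :=
  match i with
  | 0 => 1
  | 1 => 'X
  | 2 => 'X^2 - (k%:R)%:P
  | (j.+1 as i1).+1 => 'X * Fpoly R k i1 - (k%:R - 1)%:P * Fpoly R k j
  end.

Definition Gpoly (R : nzRingType) (k i : nat) : {poly R} :=
  \sum_(0 <= j < (i./2).+1) Fpoly R k (i - 2 * j).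

Definition lam (R : rcfType) (k j : nat) : R := largest_zero (Gpoly R k j).

Definition Mbound (R : fieldType) (k t : nat) (c : R) : R :=
  2 * (\sum_(0 <= i < (t - 4).+1) (k%:R - 1) ^+ i
       + (k%:R - 1) ^+ (t - 3) / c + (k%:R - 1) ^+ (t - 2) / c).

(* Main.v *)
(* Put q = k - 1.  The polynomials G_i obey G_(i+2) = x G_(i+1) - q G_i, so
   G_i(2 sqrt q cos phi) = q^(i/2) sin((i+1) phi) / sin phi and
   lambda^(j) = 2 sqrt q cos(pi / (j+1)), which gives the first claim and the
   signs of the G_l at theta.

   For the bound let i = t - 4, let K be the Christoffel-Darboux kernel of the
   G_j at theta, and f = (x^2 - theta^2) K^2 = (a G_(i+2) + b G_i) K with
   a = G_i(theta) > 0 and b = - G_(i+2)(theta) >= 0, so that c = (a + b) / a.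
   As f is even and nonpositive on [-theta, theta], and the spectrum of a
   bipartite graph is symmetric, the adjacency matrix A satisfies
   tr f(A) <= 2 f(k).  Since the F_j(A) count non-backtracking walks, the
   matrices G_l(A) have natural entries that grow with l in steps of 2, whence
   tr (G_l(A) K(A)) >= n K(k) for l = i, i+2 and tr f(A) >= n (a + b) K(k).
   Dividing by (a + b) K(k) gives n <= M(k, t, c).  The maximum exists because
   K_(k,k) is in the class. *)
Require Import Defs.
From HB Require Import structures.
From mathcomp Require Import all_boot all_order all_algebra.
From mathcomp Require Import polyrcf.
From mathcomp Require Import all_classical all_reals.
From mathcomp Require Import complex ring lra trigo.

Set Implicit Arguments.
Unset Strict Implicit.
Unset Printing Implicit Defensive.

Import Order.TTheory GRing.Theory Num.Theory.

Local Open Scope classical_set_scope.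
Local Open Scope ring_scope.

(** * Real zeros counted with multiplicity *)

Lemma count_real_zeros (R : rcfType) (p : {poly R}) (x : R) :
  p != 0 -> count_mem x (real_zeros p) = mup x p.
Proof.
move=> p0; rewrite /real_zeros count_flatten -map_comp.
have memE y : (y \in rootsR p) = root p y.
  by have := roots_on_rootsR p0 y; rewrite in_itv /= => <-.
have Hcnt y : (count_mem x \o (fun y => nseq (mup y p) y)) y
    = if y == x then mup x p else 0%N.
  by rewrite /= count_nseq /=; case: eqVneq => [->|]; rewrite ?mul1n ?mul0n.
rewrite (eq_map Hcnt) sumnE big_map -big_mkcond /=.
case: (boolP (x \in rootsR p)) => xr.
  by rewrite -big_filter (filter_pred1_uniq (uniq_roots _ _ _) xr) big_seq1.
by rewrite mupNroot -?memE // big1.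
Qed.

Lemma sorted_real_zeros (R : rcfType) (p : {poly R}) :
  sorted <=%R (real_zeros p).
Proof.
rewrite /real_zeros; have := sorted_roots (- cauchy_bound p) (cauchy_bound p) p.
rewrite -/(rootsR p) sorted_pairwise; last exact: lt_trans.
rewrite sorted_pairwise; last exact: le_trans.
elim: (rootsR p) => //= x s IHs /andP[xs /IHs ss].
rewrite pairwise_cat ss andbT; apply/andP; split.
  apply/allrelP => y z; rewrite mem_nseq => /andP[_ /eqP->] /flattenP[t].
  move=> /mapP[u us ->]; rewrite mem_nseq => /andP[_ /eqP->].
  by rewrite ltW ?(allP xs).
elim: (mup x p) => //= n ->; rewrite andbT.
by apply/allP => y; rewrite mem_nseq => /andP[_ /eqP->].
Qed.

Lemma real_zeros_prod (R : rcfType) (s : seq R) :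
  perm_eq (real_zeros (\prod_(x <- s) ('X - x%:P))) s.
Proof.
apply/allP => x _; apply/eqP => /=.
by rewrite count_real_zeros ?mu_prod_XsubC // monic_neq0 ?monic_prod_XsubC.
Qed.

Lemma largest_zeroE (R : rcfType) (p : {poly R}) (x : R) :
  p != 0 -> root p x -> (forall y, root p y -> y <= x) -> largest_zero p = x.
Proof.
move=> p0 px xmax.
have memE y : (y \in real_zeros p) = root p y.
  rewrite -has_pred1 has_count count_real_zeros //.
  by rewrite -XsubC_dvd // dvdp_XsubCl.
have xp : x \in real_zeros p by rewrite memE.
have := sorted_real_zeros p; have := xmax (last 0 (real_zeros p)).
rewrite -memE /largest_zero; case: (real_zeros p) xp => //= a s xs.
rewrite mem_last => /(_ isT) le_lx ss; apply/eqP; rewrite eq_le le_lx /=.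
case/splitPl: xs ss => s1 s2 <-; rewrite last_cat cat_path => /andP[_].
by move/(order_path_min le_trans)/allP => /(_ _) h; have := mem_last (last a s1) s2;
  rewrite inE => /orP[/eqP->|/h].
Qed.

(** * Spectra of symmetric matrices and traces of polynomials in them *)

(** Over [R[i]] the matrix is Hermitian, hence unitarily diagonalizable with real diagonal, and a
    polynomial acts on the diagonal entrywise. One list [s] serves every [p], so [p = 'X] shows that
    it is the spectrum of [A]. *)
Lemma symmetric_spectrum (R : rcfType) n (A : 'M[R]_n.+1) :
  A^T = A ->
  exists s : seq R, forall p : {poly R},
    char_poly (horner_mx A p) = \prod_(x <- s) ('X - (p.[x])%:P).
Proof.
move=> Asym; pose toC := (real_complex R : {rmorphism R -> R[i]}).
pose B := map_mx toC A.
have Bherm : B \is hermsymmx.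
  apply/is_hermitianmxP; rewrite expr0 scale1r -map_trmx -map_mx_comp.
  rewrite map_trmx Asym; apply: eq_map_mx => x.
  exact/esym/conjc_real.
have /orthomx_spectralP BE := hermitian_normalmx Bherm.
have dreal := hermitian_spectral_diag_real Bherm.
set P := spectralmx B in BE; set d := spectral_diag B in BE dreal.
have Punit : P \in unitmx := spectral_unit B.
pose r i := complex.Re (d 0 i).
have dE i : d 0 i = toC (r i).
  rewrite /r; have /mxOverP/(_ 0 i)/CrealP := dreal.
  case: (d 0 i) => a b [] /eqP; rewrite eq_sym -addr_eq0 -mulr2n.
  by rewrite mulrn_eq0 => /eqP->.
exists [seq r i | i <- enum 'I_n.+1] => p.
apply: (map_poly_inj toC); rewrite map_char_poly map_horner_mx -/B BE.
rewrite horner_mx_uconjC // horner_mx_diag.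
have -> (D : 'M[R[i]]_n.+1) : char_poly (invmx P *m D *m P) = char_poly D.
  rewrite /char_poly /char_poly_mx.
  rewrite !map_mxM map_invmx; set Q := map_mx polyC P.
  have QU : Q \in unitmx by rewrite map_unitmx.
  have {1}-> : 'X%:M = invmx Q *m 'X%:M *m Q.
    by rewrite -mulmxA -scalar_mxC mulKmx.
  rewrite -mulmxBl -mulmxBr !det_mulmx det_inv mulrAC mulVr ?mul1r //.
rewrite char_poly_trig ?diag_mx_is_trig // rmorph_prod /=.
rewrite big_map big_enum; apply: eq_bigr => i _.
by rewrite rmorphB /= map_polyX map_polyC !mxE eqxx mulr1n dE horner_map.
Qed.

Lemma trace_char_poly_prod (R : comNzRingType) n (A : 'M[R]_n.+1) (s : seq R) :
  char_poly A = \prod_(x <- s) ('X - x%:P) -> \tr A = \sum_(x <- s) x.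
Proof.
move=> As; apply: oppr_inj; rewrite -char_poly_trace // As.
have := size_char_poly A; rewrite As size_prod_XsubC => -[sn].
by rewrite -sn coefPn_prod_XsubC // sn.
Qed.

Lemma trace_horner_mx (R : comNzRingType) n (A : 'M[R]_n.+1) (s : seq R)
    (p : {poly R}) :
  char_poly (horner_mx A p) = \prod_(x <- s) ('X - (p.[x])%:P) ->
  \tr (horner_mx A p) = \sum_(x <- s) p.[x].
Proof.
move=> As; rewrite (@trace_char_poly_prod _ _ _ [seq p.[x] | x <- s]).
  by rewrite big_map.
by rewrite As big_map.
Qed.

Lemma horner_mx_eigenvector (R : comNzRingType) n (A : 'M[R]_n.+1)
    (u : 'cV[R]_n.+1) (a : R) (p : {poly R}) :
  A *m u = a *: u -> horner_mx A p *m u = p.[a] *: u.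
Proof.
move=> Au; elim/poly_ind: p => [|p c IHp].
  by rewrite rmorph0 mul0mx horner0 scale0r.
rewrite rmorphD rmorphM /= horner_mx_X horner_mx_C mulmxDl -mulmxA Au.
by rewrite -scalemxAr IHp scalerA mul_scalar_mx -scalerDl hornerMXaddC mulrC.
Qed.

Lemma trmx_horner_mx (R : comNzRingType) n (A : 'M[R]_n.+1) (p : {poly R}) :
  (horner_mx A p)^T = horner_mx A^T p.
Proof.
elim/poly_ind: p => [|p c IHp]; first by rewrite !rmorph0 trmx0.
rewrite !(rmorphD, rmorphM) /= !horner_mx_X !horner_mx_C linearD /=.
rewrite tr_scalar_mx trmx_mul IHp; congr (_ + _).
by rewrite -[RHS]/(_ *m _) (comm_horner_mx _ (erefl _)).
Qed.

(* A bipartition makes [A] similar to [- A], so the spectrum is symmetric. *)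
Lemma bipartite_char_poly (R : comUnitRingType) n (A : 'M[R]_n)
    (col : 'I_n -> bool) :
  (forall i j, col i = col j -> A i j = 0) -> char_poly (- A) = char_poly A.
Proof.
move=> bip; pose D : 'M[{poly R}]_n := diag_mx (\row_j (-1) ^+ col j).
have DD : D *m D = 1%:M.
  rewrite mulmx_diag -[RHS]diag_const_mx; congr diag_mx; apply/rowP => i.
  by rewrite !mxE -signr_addb addbb.
rewrite /char_poly; have -> : char_poly_mx (- A) = D *m char_poly_mx A *m D.
  apply/matrixP => i j; rewrite mul_diag_mx mul_mx_diag !mxE.
  case: (eqVneq i j) => [->|ij].
    rewrite bip // oppr0 rmorph0 subr0 mulr1n -mulrA mulrC -mulrA.
    by rewrite -signr_addb addbb mulr1.
  case: (eqVneq (col i) (col j)) => [/bip->|cij].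
    by rewrite oppr0 rmorph0 mulr0n subr0 mulr0 mul0r.
  rewrite mulr0n !sub0r rmorphN opprK.
  have -> : col j = ~~ col i by case: (col i) (col j) cij => [] [].
  by rewrite signrN !mulrN mulNr opprK mulrAC -signr_addb addbb mul1r.
by rewrite !det_mulmx mulrAC -det_mulmx DD det1 mul1r.
Qed.

(* Matrices indexed by #|G| do not form a ring that polynomials can be evaluated
   in (#|G| is not a successor), hence the detour through relations on ['I_n]. *)
Definition relmx (R : nzRingType) n (e : rel 'I_n) : 'M[R]_n :=
  \matrix_(i, j) (e i j)%:R.

(** * Spectrum of a regular bipartite relation *)

Section RegularRelation.

Context (R : rcfType) (n k : nat) (e : rel 'I_n.+1).
Hypothesis e_sym : symmetric e.
Hypothesis e_reg : forall i, (\sum_j e i j)%N = k.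
Local Notation A := (relmx R e).

Lemma relmx_sym : A^T = A.
Proof. by apply/matrixP => i j; rewrite !mxE e_sym. Qed.

Lemma relmx_const1 : A *m const_mx 1 = k%:R *: const_mx 1 :> 'cV_n.+1.
Proof.
apply/colP => i; rewrite !mxE mulr1 -(e_reg i) natr_sum.
by apply: eq_bigr => j _; rewrite !mxE mulr1.
Qed.

Lemma relmx_row_sum (p : {poly R}) i : \sum_j horner_mx A p i j = p.[k%:R].
Proof.
have /colP/(_ i) := horner_mx_eigenvector p relmx_const1.
by rewrite !mxE mulr1 => <-; apply: eq_bigr => j _; rewrite mxE mulr1.
Qed.

Lemma relmx_eigenvalue : root (char_poly A) k%:R.
Proof.
rewrite -eigenvalue_root_char; apply/eigenvalueP; exists (const_mx 1).
  by apply: trmx_inj; rewrite trmx_mul relmx_sym linearZ /= trmx_const relmx_const1.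
by apply/eqP => /rowP/(_ 0)/eqP; rewrite !mxE oner_eq0.
Qed.

Lemma relmx_spectrum (col : 'I_n.+1 -> bool) :
  (forall i j, e i j -> col i != col j) ->
  let s := real_zeros (char_poly A) in
  [/\ forall p : {poly R}, \tr (horner_mx A p) = \sum_(x <- s) p.[x],
      perm_eq s [seq - x | x <- s] & k%:R \in s].
Proof.
move=> bip s; have [s0 sE] := symmetric_spectrum relmx_sym.
have As0 : char_poly A = \prod_(x <- s0) ('X - x%:P).
  have := sE 'X; rewrite horner_mx_X => ->.
  by under eq_bigr do rewrite hornerX.
have s_s0 : perm_eq s s0 by rewrite /s As0 real_zeros_prod.
split=> [p||]; first by rewrite (trace_horner_mx (sE p)) (perm_big _ s_s0).
  have bipA i j : col i = col j -> A i j = 0.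
    by move=> cij; rewrite mxE; case: (boolP (e i j)) => // /bip; rewrite cij eqxx.
  suff : perm_eq s0 [seq - x | x <- s0].
    by rewrite (permPl s_s0) => /permPl->; apply: perm_map; rewrite perm_sym.
  apply: prod_XsubC_eq; rewrite -As0 -(bipartite_char_poly bipA).
  have := sE (- 'X); rewrite rmorphN /= horner_mx_X => ->.
  by rewrite big_map; apply: eq_bigr => x _; rewrite !hornerE.
by rewrite (perm_mem s_s0) -root_prod_XsubC -As0 relmx_eigenvalue.
Qed.

(** Outside [[- theta, theta]] the spectrum has only [k] and [- k], each once. These two contribute
    [p(k)] each, and every other eigenvalue contributes at most 0. *)
Lemma trace_horner_relmx_le (col : 'I_n.+1 -> bool) (theta : R) (p : {poly R}) :
  (forall i j, e i j -> col i != col j) ->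
  (rev (real_zeros (char_poly A)))`_1 <= theta -> 0 <= theta < k%:R ->
  (forall x, p.[- x] = p.[x]) ->
  (forall x, - theta <= x <= theta -> p.[x] <= 0) ->
  \tr (horner_mx A p) <= 2 * p.[k%:R].
Proof.
move=> bip lam2 /andP[th0 thk] p_even p_le0.
have [-> s_sym sk] := relmx_spectrum bip.
set s := real_zeros (char_poly A) in lam2 s_sym sk *.
have bigk : \sum_(x <- s | theta < x) p.[x] = p.[k%:R].
  have := sorted_real_zeros (char_poly A); rewrite -/s.
  move: lam2 sk; case/lastP: s {s_sym} => // s' l.
  rewrite rev_rcons mem_rcons inE /= => lam2 sk ss.
  (* In a nondecreasing list, entry 1 of the reverse is the last but one, so it bounds everything
     before the final [l]. *)
  have s'th x : x \in s' -> x <= theta.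
    move=> xs'; apply: le_trans lam2.
    case/lastP: s' xs' ss {sk} => // s'' y; rewrite rev_rcons /= mem_rcons inE.
    case/orP => [/eqP-> //|xs'']; rewrite sorted_pairwise; last exact: le_trans.
    by rewrite !pairwise_rcons => /andP[_ /andP[/allP/(_ _ xs'')]].
  have lk : k%:R = l.
    by case/predU1P: sk => // /s'th; rewrite leNgt thk.
  rewrite -cats1 big_cat big_cons big_nil /= -lk thk addr0 big_seq_cond.
  rewrite big1 ?add0r //.
  by move=> x /andP[/s'th]; rewrite leNgt => /negP.
have <- : \sum_(x <- s | theta < x) p.[x] + \sum_(x <- s | x < - theta) p.[x]
    = 2 * p.[k%:R].
  rewrite bigk (perm_big _ s_sym) big_map /=.
  under eq_bigl do rewrite ltrN2; under eq_bigr do rewrite p_even.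
  by rewrite bigk mulr_natl mulr2n.
rewrite [X in _ <= X + _]big_mkcond [X in _ <= _ + X]big_mkcond -big_split /=.
apply: ler_sum => x _; case: (ltP theta x) => thx; case: (ltP x (- theta)) => xth.
- by have := lt_trans thx xth; lra.
- by rewrite addr0.
- by rewrite add0r.
- by rewrite addr0 p_le0 // xth.
Qed.

(** For order [2k] the trace of [A^2] is [2k * k], which the eigenvalues [k] and [- k] already use
    up, so all others vanish. *)
Lemma lambda2_order_2k (col : 'I_n.+1 -> bool) :
  (0 < k)%N -> n.+1 = (2 * k)%N -> (forall i j, e i j -> col i != col j) ->
  (rev (real_zeros (char_poly A)))`_1 <= 0.
Proof.
move=> k0 nk bip; have [trE s_sym sk] := relmx_spectrum bip.
have := sorted_real_zeros (char_poly A).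
set s := real_zeros (char_poly A) in trE s_sym sk * => ss.
have kR : 0 < k%:R :> R by rewrite ltr0n.
have sNk : - k%:R \in s by rewrite (perm_mem s_sym) map_f.
have s1 := perm_to_rem sk.
have : - k%:R \in rem k%:R s.
  have := sNk; rewrite (perm_mem s1) inE => /orP[|//].
  by rewrite lt_eqF // (@lt_trans _ _ 0) ?oppr_lt0.
move=> /perm_to_rem; set s2 := rem _ (rem _ _) => s2E.
have {s1 s2E}s2E : perm_eq s [:: k%:R, - k%:R & s2].
  by rewrite (permPl s1) perm_cons.
have s2_0 : \sum_(x <- s2) x ^+ 2 = 0.
  have := trE 'X^2; rewrite rmorphXn /= horner_mx_X (perm_big _ s2E) /=.
  rewrite !big_cons !hornerXn; under eq_bigr do rewrite hornerXn.
  have -> : \tr (A ^+ 2) = 2 * k%:R * k%:R.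
    rewrite -natrM -nk /mxtrace (eq_bigr (fun=> k%:R)); last first.
      move=> i _; rewrite expr2 mxE -(e_reg i) natr_sum.
      by apply: eq_bigr => j _; rewrite !mxE (e_sym j i); case: (e i j);
        rewrite ?mulr1 ?mulr0.
    by rewrite sumr_const card_ord mulr_natl.
  by move=> H; lra.
have s2_all x : x \in s2 -> x = 0.
  move=> xs; move/eqP: s2_0; rewrite psumr_eq0 => [|y _]; last exact: sqr_ge0.
  by move=> /allP/(_ _ xs); rewrite sqrf_eq0 => /eqP.
have cnt : count (fun x => 0 < x) s = 1%N.
  rewrite (permP s2E) /= kR oppr_gt0 ltNge (ltW kR) /=.
  rewrite (eq_in_count (a2 := pred0)) ?count_pred0 // => x /s2_all->.
  by rewrite ltxx.
move: ss cnt; case/lastP: s {trE s_sym sk sNk s2 s2E s2_0 s2_all} => // s l.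
case/lastP: s => // s y; rewrite !rev_rcons /= sorted_pairwise; last exact: le_trans.
rewrite !pairwise_rcons all_rcons => /andP[/andP[yl _] _].
rewrite -!cats1 !count_cat /= !addn0 [y <= 0]leNgt => cnt; apply/negP => y0.
by move: cnt; rewrite y0 (lt_le_trans y0 yl) /= !addn1.
Qed.

End RegularRelation.

(** * Recurrences, parity and values at [k] of the [G_i]; the Christoffel-Darboux identity *)

Section GPolynomials.

Context (R : comNzRingType) (k : nat).
Local Notation q := (k%:R - 1 : R).
Local Notation F := (Fpoly R k).
Local Notation G := (Gpoly R k).

Lemma Gpoly0 : G 0 = 1.
Proof. by rewrite /Gpoly /= big_nat1. Qed.

Lemma Gpoly1 : G 1 = 'X.
Proof. by rewrite /Gpoly /= big_nat1. Qed.

Lemma GpolySS i : G i.+2 = F i.+2 + G i.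
Proof.
rewrite /Gpoly /= big_nat_recl // muln0; congr (_ + _).
by apply: eq_bigr => j _; rewrite mulnS.
Qed.

Lemma FpolySSS i : F i.+3 = 'X * F i.+2 - q%:P * F i.+1.
Proof. by []. Qed.

Lemma Gpoly_rec i : G i.+2 = 'X * G i.+1 - q%:P * G i.
Proof.
suff [] : G i.+2 = 'X * G i.+1 - q%:P * G i /\
          G i.+3 = 'X * G i.+2 - q%:P * G i.+1 by [].
elim: i => [|i [IH1 IH2]].
  (* The irregular [F 2], with [k] in place of [k - 1], enters only these two base cases. *)
  rewrite !GpolySS FpolySSS Gpoly0 Gpoly1 /= rmorphB /= polyC1.
  by split; ring.
split => //; rewrite !(GpolySS i.+2) FpolySSS {1}IH1 (GpolySS i.+1) (GpolySS i).
by ring.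
Qed.

(** This form keeps the parity of the index and involves ['X] only through its square, as the factor
    ['X^2 - theta^2] of the kernel identity requires. *)
Lemma Gpoly_step2 i : G i.+4 = ('X^2 - (q *+ 2)%:P) * G i.+2 - (q ^+ 2)%:P * G i.
Proof.
rewrite (Gpoly_rec i.+2) (Gpoly_rec i.+1).
have -> : 'X * ('X * G i.+2 - q%:P * G i.+1) =
    'X^2 * G i.+2 - q%:P * (G i.+2 + q%:P * G i) by rewrite (Gpoly_rec i); ring.
by rewrite rmorphMn rmorphXn /=; ring.
Qed.

Lemma horner_GpolyN i x : (G i).[- x] = (-1) ^+ i * (G i).[x].
Proof.
suff [] : (G i).[- x] = (-1) ^+ i * (G i).[x] /\
          (G i.+1).[- x] = (-1) ^+ i.+1 * (G i.+1).[x] by [].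
elim: i => [|i [IH1 IH2]].
  by rewrite Gpoly0 Gpoly1 !hornerE; split; ring.
split => //; rewrite Gpoly_rec !hornerE IH1 IH2 !exprS; ring.
Qed.

Lemma horner_Gpoly_degree i : (G i).[k%:R] = \sum_(0 <= l < i.+1) q ^+ l.
Proof.
suff [] : (G i).[k%:R] = \sum_(0 <= l < i.+1) q ^+ l /\
          (G i.+1).[k%:R] = \sum_(0 <= l < i.+2) q ^+ l by [].
elim: i => [|i [IH1 IH2]].
  rewrite Gpoly0 Gpoly1 !hornerE !big_nat1 big_nat_recr //= big_nat1 expr0 expr1.
  by split=> //; ring.
split => //; rewrite Gpoly_rec !hornerE IH1 IH2.
by rewrite (big_nat_recr i.+2) // !(big_nat_recr i.+1) //= !exprS; ring.
Qed.

(** This is [k (k-1)^(i+1)], split into the two powers that end [Mbound]. *)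
Lemma horner_Fpoly_degree i : (F i.+2).[k%:R] = q ^+ i.+1 + q ^+ i.+2.
Proof.
have := congr1 (fun p => p.[k%:R]) (GpolySS i).
rewrite hornerD !horner_Gpoly_degree !big_nat_recr //= => /eqP.
by rewrite -subr_eq => /eqP<-; ring.
Qed.

(* The Christoffel-Darboux kernel of the [G j] with [j = i] modulo 2:
   the sum over even [l <= i] of [q^l G_(i-l)(theta) G_(i-l)(x)]. *)
Fixpoint cdker (theta : R) (i : nat) : {poly R} :=
  match i with
  | j.+2 => (G j.+2).[theta] *: G j.+2 + q ^+ 2 *: cdker theta j
  | _ => (G i).[theta] *: G i
  end.

Lemma cdkerSS theta i :
  cdker theta i.+2 = (G i.+2).[theta] *: G i.+2 + q ^+ 2 *: cdker theta i.
Proof. by []. Qed.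

(** Expand [G_(i+4)] by [Gpoly_step2] both as a polynomial and at [theta]: the terms in [2q] cancel,
    and those in [q^2] reproduce the identity for [i]. *)
Lemma christoffel_darboux theta i :
  ('X^2 - (theta ^+ 2)%:P) * cdker theta i =
  (G i).[theta] *: G i.+2 - (G i.+2).[theta] *: G i.
Proof.
suff [] : ('X^2 - (theta ^+ 2)%:P) * cdker theta i =
  (G i).[theta] *: G i.+2 - (G i.+2).[theta] *: G i /\
   ('X^2 - (theta ^+ 2)%:P) * cdker theta i.+1 =
  (G i.+1).[theta] *: G i.+3 - (G i.+3).[theta] *: G i.+1 by [].
elim: i => [|i [IH1 IH2]].
  rewrite /cdker !Gpoly_rec Gpoly0 Gpoly1 !hornerE -!mul_polyC.
  by split; rewrite !(rmorphB, rmorphM, rmorphXn) /=; ring.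
split => //; rewrite cdkerSS mulrDr -!scalerAr IH1 !Gpoly_step2 !hornerE.
by rewrite -!mul_polyC !(rmorphB, rmorphM, rmorphXn, rmorphMn) /=; ring.
Qed.

Lemma horner_cdkerN theta i x :
  (cdker theta i).[- x] = (-1) ^+ i * (cdker theta i).[x].
Proof.
suff [] : (cdker theta i).[- x] = (-1) ^+ i * (cdker theta i).[x] /\
  (cdker theta i.+1).[- x] = (-1) ^+ i.+1 * (cdker theta i.+1).[x] by [].
elim: i => [|i [IH1 IH2]].
  by rewrite /cdker !hornerZ !horner_GpolyN; split; ring.
split => //; rewrite cdkerSS !hornerE IH1 horner_GpolyN !exprS; ring.
Qed.

End GPolynomials.

(** * Non-backtracking walks as entries of [F_i(A)] and [G_i(A)] *)

Section NonBacktracking.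

Context (n k : nat) (e : rel 'I_n.+1).
Hypothesis e_sym : symmetric e.
Hypothesis e_reg : forall i, (\sum_j e i j)%N = k.

(* [nbarc i x y z] counts the non-backtracking walks of length [i + 1] from [x]
   whose last step is the arc [y -> z]; [nbwalk i x z] those of length [i] from
   [x] to [z]. *)
Fixpoint nbarc (i : nat) (x y z : 'I_n.+1) : nat :=
  if i is j.+1 then e y z * \sum_(u | u != z) nbarc j x u y
  else (x == y) * e y z.

Definition nbwalk (i : nat) (x z : 'I_n.+1) : nat :=
  if i is j.+1 then \sum_y nbarc j x y z else (x == z).

Lemma nbarc_edge i x y z : (e y z * nbarc i x y z)%N = nbarc i x y z.
Proof. by case: i => [|i] /=; case: (e y z); rewrite ?mul1n ?muln0. Qed.

Lemma sum_nbarc0 x y : (\sum_z nbarc 0 x y z)%N = (k * (x == y))%N.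
Proof. by rewrite /= -big_distrr /= e_reg mulnC. Qed.

(** A non-backtracking walk of positive length extends in [k - 1] ways, to every neighbour of its
    end but the one it came from. The additive form avoids subtraction in [nat]. *)
Lemma sum_nbarcS i x y :
  (\sum_z nbarc i.+1 x y z + nbwalk i.+1 x y = k * nbwalk i.+1 x y)%N.
Proof.
have -> : (nbwalk i.+1 x y = \sum_z nbarc i x z y)%N by [].
rewrite -[in RHS](e_reg y) big_distrl /= -big_split /=; apply: eq_bigr => z _.
rewrite -[nbarc i x z y]nbarc_edge (e_sym z y) -mulnDr; congr (_ * _)%N.
by rewrite [RHS](bigD1 z) //= addnC.
Qed.

(** A walk followed by an arc either stays non-backtracking or reverses its last arc [z -> y]; the
    second sum counts the latter. *)
Lemma nbwalk_rec i x z :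
  (\sum_y nbwalk i.+1 x y * e y z =
   nbwalk i.+2 x z + \sum_y nbarc i x z y)%N.
Proof.
rewrite /= -big_split /=; apply: eq_bigr => y _.
rewrite mulnC -[nbarc i x z y]nbarc_edge (e_sym z y) -mulnDr; congr (_ * _)%N.
by rewrite [LHS](bigD1 z) //= addnC.
Qed.

Variable R : comNzRingType.
Local Notation A := (relmx R e).
Local Notation q := (k%:R - 1 : R).

Lemma horner_Fpoly_relmx i x z :
  horner_mx A (Fpoly R k i) x z = (nbwalk i x z)%:R.
Proof.
have mulA (p : {poly R}) : horner_mx A ('X * p) = horner_mx A p *m A.
  by rewrite mulrC rmorphM /= horner_mx_X.
have subA (p r : {poly R}) :
    horner_mx A (p - r) = horner_mx A p - horner_mx A r by exact: rmorphB.
have scaleA c (p : {poly R}) : horner_mx A (c%:P * p) = c *: horner_mx A p.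
  by rewrite mul_polyC linearZ.
have F1 x' z' : horner_mx A (Fpoly R k 1) x' z' = (nbwalk 1 x' z')%:R.
  rewrite horner_mx_X mxE /= (bigD1 x') //= eqxx mul1n big1 ?addn0 //.
  by move=> y; rewrite eq_sym => /negPf->.
have mulAE (p : {poly R}) i' : (forall x' z',
    horner_mx A p x' z' = (nbwalk i'.+1 x' z')%:R) -> forall x' z',
    horner_mx A ('X * p) x' z' =
    (nbwalk i'.+2 x' z' + \sum_y nbarc i' x' z' y)%:R.
  move=> pE x' z'; rewrite mulA mxE -nbwalk_rec natr_sum.
  by apply: eq_bigr => y _; rewrite pE mxE natrM.
suff [] : (forall x' z', horner_mx A (Fpoly R k i) x' z' = (nbwalk i x' z')%:R) /\
   (forall x' z', horner_mx A (Fpoly R k i.+1) x' z' = (nbwalk i.+1 x' z')%:R)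
  by move=> h _; apply: h.
elim: i {x z} => [|i [IH1 IH2]].
  by split=> // x z; rewrite /= rmorph1 mxE.
split=> // x z; case: i IH1 IH2 => [|i] IH1 IH2.
  (* Turning back after one step returns to the start, in [k] ways; this is why [F 2] has [k] and
     not [k - 1]. *)
  have -> : Fpoly R k 2 = 'X * Fpoly R k 1 - (k%:R)%:P by [].
  rewrite subA !mxE (mulAE _ 0) // horner_mx_C sum_nbarc0 mxE natrD.
  by rewrite natrM mulr_natr addrK.
rewrite FpolySSS subA scaleA !mxE (mulAE _ i.+1) // IH1 natrD.
(* From length 3 on, walks turning back only at the last step number [k - 1] for each walk two steps
   shorter. *)
have := congr1 (fun m => m%:R : R) (sum_nbarcS i x z).
rewrite natrD natrM => /esym/eqP; rewrite -subr_eq => /eqP H.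
have {}H : (\sum_y nbarc i.+1 x z y)%:R = q * (nbwalk i.+1 x z)%:R :> R.
  by rewrite -H; ring.
rewrite H; ring.
Qed.

Fixpoint nbwalks (i : nat) (x z : 'I_n.+1) : nat :=
  if i is j.+2 then nbwalk j.+2 x z + nbwalks j x z else nbwalk i x z.

Lemma horner_Gpoly_relmx i x z :
  horner_mx A (Gpoly R k i) x z = (nbwalks i x z)%:R.
Proof.
suff [] : horner_mx A (Gpoly R k i) x z = (nbwalks i x z)%:R /\
  horner_mx A (Gpoly R k i.+1) x z = (nbwalks i.+1 x z)%:R by [].
elim: i => [|i [IH1 IH2]].
  rewrite /= -(horner_Fpoly_relmx 0) -(horner_Fpoly_relmx 1).
  by rewrite Gpoly0 Gpoly1.
by split=> //; rewrite GpolySS rmorphD mxE horner_Fpoly_relmx IH1 -natrD.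
Qed.

Lemma nbwalks_mono i j x z : (nbwalks i x z <= nbwalks (i + j.*2) x z)%N.
Proof.
elim: j => [|j IHj]; first by rewrite addn0.
by rewrite doubleS !addnS (leq_trans IHj) ?leq_addl.
Qed.

End NonBacktracking.

(** * The linear programming bound on the order *)

Section LinearProgrammingBound.

Context (R : rcfType) (n k : nat) (e : rel 'I_n.+1).
Hypothesis e_sym : symmetric e.
Hypothesis e_reg : forall i, (\sum_j e i j)%N = k.
Local Notation A := (relmx R e).
Local Notation G := (Gpoly R k).

(* The entries of [G_(i+2j)(A) - G_i(A)] and [G_i(A)] are nonnegative integers,
   so each product of entries is at least the entry of [G_i(A)]. *)
Lemma trace_Gpoly_ge i j :
  n.+1%:R * (G i).[k%:R] <= \tr (horner_mx A (G (i + j.*2) * G i)).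
Proof.
have -> : n.+1%:R * (G i).[k%:R] = \sum_(x < n.+1) (G i).[k%:R].
  by rewrite sumr_const card_ord mulr_natl.
apply: ler_sum => x _; rewrite -(relmx_row_sum e_reg (G i) x) rmorphM mxE.
apply: ler_sum => y _.
have -> : horner_mx A (G i) y x = horner_mx A (G i) x y.
  by rewrite -[in LHS](relmx_sym R e_sym) -trmx_horner_mx mxE.
rewrite !(horner_Gpoly_relmx e_sym e_reg) -natrM ler_nat.
have := nbwalks_mono e i j x y.
case: (nbwalks e i x y) => // m le_m.
by rewrite leq_pmull // (leq_trans _ le_m).
Qed.

(** The kernel combines the [G l] with [l <= i] of the parity of [i], with nonnegative coefficients,
    and [trace_Gpoly_ge] applies to each of them. *)
Lemma trace_cdker_ge theta i j :
  (forall l, (l <= i)%N -> 0 <= (G l).[theta]) ->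
  n.+1%:R * (cdker k theta i).[k%:R] <=
  \tr (horner_mx A (G (i + j.*2) * cdker k theta i)).
Proof.
have base l c m : 0 <= c -> n.+1%:R * (c *: G l).[k%:R]
    <= \tr (horner_mx A (G (l + m.*2) * (c *: G l))).
  move=> c0; rewrite -scalerAr linearZ /= mxtraceZ hornerZ mulrCA.
  by rewrite ler_wpM2l // trace_Gpoly_ge.
suff [] : (forall j, (forall l, (l <= i)%N -> 0 <= (G l).[theta]) ->
  n.+1%:R * (cdker k theta i).[k%:R] <=
  \tr (horner_mx A (G (i + j.*2) * cdker k theta i))) /\
  (forall j, (forall l, (l <= i.+1)%N -> 0 <= (G l).[theta]) ->
  n.+1%:R * (cdker k theta i.+1).[k%:R] <=
  \tr (horner_mx A (G (i.+1 + j.*2) * cdker k theta i.+1)))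
  by move=> h _; apply: h.
elim: i {j} => [|i [IH1 IH2]].
  by split=> j G_ge0; apply: base; apply: G_ge0.
split=> // j G_ge0; rewrite cdkerSS mulrDr rmorphD /= mxtraceD hornerD mulrDr.
apply: lerD; first by apply: base; apply: G_ge0.
rewrite -scalerAr linearZ /= mxtraceZ hornerZ mulrCA.
(* Passing from [i + 2] to [i] is compensated by raising [j] by 1, so the first factor does not
   change. *)
rewrite ler_wpM2l ?sqr_ge0 // !addSn -!addnS -doubleS.
by apply: IH1 => l li; apply: G_ge0; rewrite (leq_trans li) // leqW.
Qed.

Lemma order_le_Mbound (col : 'I_n.+1 -> bool) (theta : R) (t : nat) :
  (1 < k)%N -> (4 <= t)%N ->
  (forall i j, e i j -> col i != col j) ->
  (rev (real_zeros (char_poly A)))`_1 <= theta -> 0 <= theta < k%:R ->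
  (forall l, (l <= t - 4)%N -> 0 < (G l).[theta]) ->
  (G (t - 2)).[theta] <= 0 ->
  n.+1%:R <= Mbound k t
    (- (Fpoly R k (t - 2)).[theta] / (G (t - 4)).[theta]).
Proof.
move=> k1; case: t => [|[|[|[|i]]]] // _; rewrite /Mbound !subSS !subn0.
move=> bip lam2 th G_gt0 G_le0; have /andP[th0 thk] := th.
set K := cdker k theta i.
pose al := (G i).[theta]; pose be := - (G i.+2).[theta].
have al0 : 0 < al by exact: G_gt0.
have be0 : 0 <= be by rewrite oppr_ge0.
pose f := ('X^2 - (theta ^+ 2)%:P) * K ^+ 2.
have fE : f = al *: (G (i + 1.*2) * K) + be *: (G (i + 0.*2) * K).
  rewrite /f expr2 mulrA christoffel_darboux mulrBl -!scalerAl scaleNr.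
  by rewrite addn0 addnS addn1.
have f_even x : f.[- x] = f.[x].
  rewrite /f !(hornerM, hornerD, hornerN, horner_exp, hornerX, hornerC).
  rewrite horner_cdkerN -/K mulrNN mulrACA.
  by rewrite -[(-1) ^+ i * _]expr2 sqrr_sign mul1r.
have f_le0 x : - theta <= x <= theta -> f.[x] <= 0.
  move=> xth; have -> : f.[x] = (x ^+ 2 - theta ^+ 2) * K.[x] ^+ 2.
    by rewrite /f !hornerE.
  rewrite mulr_le0_ge0 ?sqr_ge0 //.
  by rewrite subr_le0 -ler_sqrt ?exprn_ge0 // !sqrtr_sqr (ger0_norm th0) ler_norml.
have q0 : 0 < k%:R - 1 :> R by rewrite subr_gt0 ltr1n.
have Gk_gt0 l : 0 < (G l).[k%:R].
  rewrite horner_Gpoly_degree big_nat_recl // ltr_wpDr ?expr0 //.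
  by apply: sumr_ge0 => m _; rewrite exprn_ge0 // ltW.
have K_gt0 : 0 < K.[k%:R].
  suff [] : ((forall l, (l <= i)%N -> 0 < (G l).[theta]) ->
     0 < (cdker k theta i).[k%:R]) /\
   ((forall l, (l <= i.+1)%N -> 0 < (G l).[theta]) ->
     0 < (cdker k theta i.+1).[k%:R]) by move=> h _; apply: h.
  elim: i {K al be al0 be0 f fE f_even f_le0 G_gt0 G_le0} => [|i [IH1 IH2]].
    by split=> G_gt0; rewrite /cdker hornerZ mulr_gt0 ?G_gt0.
  split=> // G_gt0; rewrite cdkerSS hornerD !hornerZ addr_gt0 ?mulr_gt0 ?G_gt0 //.
  by apply: IH1 => l li; apply: G_gt0; rewrite (leq_trans li) // leqW.
have upper := trace_horner_relmx_le e_sym e_reg bip lam2 th f_even f_le0.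
have lower : n.+1%:R * ((al + be) * K.[k%:R]) <= \tr (horner_mx A f).
  rewrite fE rmorphD /= !linearZ /= mxtraceD !mxtraceZ !mulrDl mulrDr.
  by apply: lerD; rewrite mulrCA ler_wpM2l ?(ltW al0) // trace_cdker_ge // =>
    l /G_gt0/ltW.
have {upper}lower := le_trans lower upper.
have fk : f.[k%:R] = (al * (G i.+2).[k%:R] + be * (G i).[k%:R]) * K.[k%:R].
  by rewrite fE addnS addn1 addn0 !(hornerD, hornerZ, hornerM) mulrDl !mulrA.
have {}lower : n.+1%:R * (al + be) <=
    2 * (al * (G i.+2).[k%:R] + be * (G i).[k%:R]).
  by rewrite -(ler_pM2r K_gt0) -!mulrA -fk.
have ab : 0 < al + be by rewrite ltr_wpDr.
(* [F_(i+2) = G_(i+2) - G_i], so minus its value at [theta] is [al + be]. *)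
have -> : - (Fpoly R k i.+2).[theta] / (G i).[theta] = (al + be) / al.
  by congr (_ / _); rewrite /al /be GpolySS hornerD; ring.
(* As [G_(i+2)(k) = G_i(k) + F_(i+2)(k)], the bound equals [2 (G_i(k) + F_(i+2)(k) / c)], which is
   [Mbound]. *)
move: lower; rewrite -ler_pdivlMr // GpolySS hornerD horner_Fpoly_degree.
rewrite horner_Gpoly_degree => /le_trans; apply; rewrite le_eqVlt; apply/orP; left.
by apply/eqP; field; rewrite !gt_eqF.
Qed.

End LinearProgrammingBound.

(** * Transfer from graphs to relations on ordinals *)

Section AdjacencyRelation.

Context (k : nat) (Gr : sgraph).

Definition ord_adj : rel 'I_#|Gr| := fun i j => adj (enum_val i) (enum_val j).

Lemma adjmxE (R : rcfType) : adjmx R Gr = relmx R ord_adj.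
Proof. by []. Qed.

Lemma ord_adj_sym : symmetric ord_adj.
Proof. by move=> i j; rewrite /ord_adj adj_sym. Qed.

Lemma ord_adj_regular : regular k Gr -> forall i, (\sum_j ord_adj i j)%N = k.
Proof.
move=> reg i; rewrite -(reg (enum_val i)) -sum1dep_card [RHS]big_mkcond /=.
rewrite -(big_enum_val (fun y => nat_of_bool (adj (enum_val i) y))) /=.
by apply: eq_bigr => y _; case: adj.
Qed.

Lemma ord_adj_bipartite : bipartite Gr ->
  exists col : 'I_#|Gr| -> bool, forall i j, ord_adj i j -> col i != col j.
Proof. by case=> B hB; exists (fun i => enum_val i \in B) => i j /hB. Qed.

End AdjacencyRelation.

Lemma b_class_order_le (R : rcfType) (k t : nat) (theta : R) (Gr : sgraph) :
  (1 < k)%N -> (4 <= t)%N -> 0 <= theta < k%:R ->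
  (forall l, (l <= t - 4)%N -> 0 < (Gpoly R k l).[theta]) ->
  (Gpoly R k (t - 2)).[theta] <= 0 ->
  b_class k theta Gr ->
  (Defs.order Gr)%:R <= Mbound k t
    (- (Fpoly R k (t - 2)).[theta] / (Gpoly R k (t - 4)).[theta]).
Proof.
move=> k1 t4 th G_gt0 G_le0 [[Gr0 _] /ord_adj_bipartite[col bip] reg].
rewrite /lambda2 adjmxE /Defs.order.
have := ord_adj_regular reg; move: (@ord_adj_sym Gr).
(* Nonemptiness, a part of connectedness, makes [#|Gr|] a successor. *)
move: Gr0 col (@ord_adj Gr) bip; case: #|Gr| => // n _ col e bip sym regE lam2.
exact: (order_le_Mbound sym regE k1 t4 bip lam2 th G_gt0 G_le0).
Qed.

(** * The complete bipartite graph [K_(k,k)] as a member of the class *)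

Section CompleteBipartite.

Variable k : nat.

Definition cb_adj : rel (bool * 'I_k) := fun u v => u.1 != v.1.

Lemma cb_adj_sym : symmetric cb_adj.
Proof. by move=> u v; rewrite /cb_adj eq_sym. Qed.

Lemma cb_adj_irr : irreflexive cb_adj.
Proof. by move=> u; rewrite /cb_adj eqxx. Qed.

Definition complete_bipartite : sgraph := SGraph cb_adj_sym cb_adj_irr.

Lemma order_complete_bipartite : Defs.order complete_bipartite = (2 * k)%N.
Proof. by rewrite /Defs.order card_prod card_bool card_ord. Qed.

Lemma complete_bipartite_b_class (R : rcfType) (theta : R) :
  (0 < k)%N -> 0 <= theta -> b_class k theta complete_bipartite.
Proof.
move=> k0 th0.
have bip : bipartite complete_bipartite.
  by exists [set u : bool * 'I_k | u.1]%SET => u v /=; rewrite !inE /cb_adj;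
    case: u.1 v.1 => [] [].
have reg : regular k complete_bipartite.
  move=> [b i]; have inj : injective (pair (~~ b) : 'I_k -> _) by move=> x y [].
  rewrite -[RHS]card_ord -(card_imset _ inj).
  apply: eq_card => -[b' j]; rewrite !inE /= /cb_adj /=.
  apply/idP/imsetP => [bb'|[j' _ [-> _]]]; last by case: (b).
  by exists j => //; congr pair; case: (b) b' bb' => [] [].
split=> //.
  have ord : Defs.order complete_bipartite = (2 * k)%N := order_complete_bipartite.
  split=> [|u v]; first by rewrite -/(Defs.order _) ord muln_gt0.
  have [uv|uv] := eqVneq u.1 v.1; last exact: connect1.
  apply: (connect_trans (y := (~~ u.1, u.2))); apply: connect1 => /=.
    by rewrite /cb_adj; case: u.1.
  by rewrite /cb_adj uv; case: v.1.
apply: le_trans th0; rewrite /lambda2 adjmxE.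
have [col cbip] := ord_adj_bipartite bip; have := ord_adj_regular reg.
have := @ord_adj_sym complete_bipartite; have := order_complete_bipartite.
rewrite /Defs.order; move: col (@ord_adj complete_bipartite) cbip.
case: #|_| => [|n] col e cbip nk sym regE.
  by move/esym/eqP: nk; rewrite muln_eq0 /= eqn0Ngt k0.
exact: (lambda2_order_2k R sym regE k0 nk cbip).
Qed.

End CompleteBipartite.

(** * Largest zeros of the [G_j] and signs of their values *)

Section LargestZero.

Context (R : realType) (k : nat).
Hypothesis k1 : (1 < k)%N.
Local Notation G := (Gpoly R k).
Local Notation rho := (Num.sqrt (k%:R - 1 : R)).

Lemma rho_sqr : rho ^+ 2 = k%:R - 1.
Proof. by rewrite sqr_sqrtr // subr_ge0 ler1n ltnW. Qed.

Lemma rho_gt0 : 0 < rho.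
Proof. by rewrite sqrtr_gt0 subr_gt0 ltr1n. Qed.

(** This is [(rho - 1)^2 >= 0]; it serves to place [theta] below the eigenvalue [k]. *)
Lemma rho2_le_degree : 2 * rho <= k%:R.
Proof.
have := sqr_ge0 (rho - 1); rewrite sqrrB1 rho_sqr -mulr_natl; lra.
Qed.

Lemma horner_Gpoly_rec i x :
  (G i.+2).[x] = x * (G i.+1).[x] - rho ^+ 2 * (G i).[x].
Proof.
by rewrite rho_sqr Gpoly_rec !(hornerD, hornerN, hornerM, hornerX, hornerC).
Qed.

(* [G i] is a rescaled Chebyshev polynomial of the second kind. *)
Lemma horner_Gpoly_cos i (phi : R) :
  (G i).[2 * rho * cos phi] * sin phi = rho ^+ i * sin (i.+1%:R * phi).
Proof.
suff [] : (G i).[2 * rho * cos phi] * sin phi = rho ^+ i * sin (i.+1%:R * phi) /\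
    (G i.+1).[2 * rho * cos phi] * sin phi = rho ^+ i.+1 * sin (i.+2%:R * phi)
  by [].
elim: i => [|i [IH1 IH2]].
  rewrite Gpoly0 Gpoly1 hornerX -polyC1 hornerC expr0 expr1 !mul1r; split=> //.
  by rewrite [2 * phi]mulr_natl sin_mulr2n mulr2n; ring.
split=> //; rewrite horner_Gpoly_rec.
have -> : i.+3%:R * phi = i.+2%:R * phi + phi by rewrite -natr1; ring.
have H1 : i.+1%:R * phi = i.+2%:R * phi - phi by rewrite -[in RHS]natr1; ring.
rewrite H1 sinB in IH1; rewrite sinD; set y := 2 * rho * cos phi in IH1 IH2 *.
rewrite [LHS]mulrBl -(mulrA y) -(mulrA (rho ^+ 2)) IH2 IH1 /y !exprS; ring.
Qed.

(** The ratio bound [G_(i+1) >= rho G_i] propagates: [x G_(i+1) - rho^2 G_i >= 2 rho G_(i+1) - rho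
    G_(i+1)]. *)
Lemma Gpoly_gt0_ge i x : 2 * rho <= x -> 0 < (G i).[x].
Proof.
move=> rx; have r0 := rho_gt0.
suff [] : 0 < (G i).[x] /\ rho * (G i).[x] <= (G i.+1).[x] by [].
elim: i => [|i [Gi0 le_Gi]]; first by rewrite Gpoly0 Gpoly1 !hornerE; split; lra.
have Gi1 : 0 < (G i.+1).[x] by apply: lt_le_trans le_Gi; rewrite mulr_gt0.
split=> //; rewrite horner_Gpoly_rec.
have := ler_wpM2l (ltW r0) le_Gi; have := ler_wpM2r (ltW Gi1) rx; lra.
Qed.

Lemma cosP x : - (2 * rho) < x < 2 * rho ->
  exists2 phi : R, 0 < phi < pi & x = 2 * rho * cos phi.
Proof.
move=> /andP[lx xl]; have r2 : 0 < 2 * rho by rewrite mulr_gt0 // rho_gt0.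
have y1 : -1 < x / (2 * rho) by rewrite ltr_pdivlMr // mulN1r.
have y2 : x / (2 * rho) < 1 by rewrite ltr_pdivrMr // mul1r.
exists (acos (x / (2 * rho))).
  by rewrite acos_gt0 ?acos_ltpi // ?y1 ?y2 ?(ltW y1) ?(ltW y2).
rewrite acosK ?in_itv /= ?(ltW y1) ?(ltW y2) //.
by rewrite mulrC divfK // gt_eqF.
Qed.

Lemma ltr_rhocos : {in `[0, pi] &,
  {mono (fun phi : R => 2 * rho * cos phi) : x y /~ y < x}}.
Proof.
move=> x y x0 y0 /=; rewrite ltr_pM2l ?mulr_gt0 ?rho_gt0 //.
exact: ltr_cos.
Qed.

Lemma pi_div_itv j : 0 < (pi / j.+1%:R : R) <= pi.
Proof.
by rewrite divr_gt0 ?pi_gt0 // ler_pdivrMr // ler_peMr ?pi_ge0 // ler1n.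
Qed.

Lemma rhocos_lt j : 2 * rho * cos (pi / j.+1%:R) < 2 * rho.
Proof.
have /andP[j0 jpi] := pi_div_itv j.
rewrite -[X in _ < X]mulr1 -[X in _ < _ * X]cos0.
by rewrite ltr_rhocos // in_itv /= ?lexx ?pi_ge0 // ltW.
Qed.

(** Below [2 rho] put [x = 2 rho cos phi]; then [0 < (j+1) phi < pi], where the sine is positive. *)
Lemma Gpoly_gt0 j x : 2 * rho * cos (pi / j.+1%:R) < x -> 0 < (G j).[x].
Proof.
move=> jx; have [|xr] := leP (2 * rho) x; first exact: Gpoly_gt0_ge.
have r0 := rho_gt0.
have [|phi /andP[p0 ppi] xE] := @cosP x.
  rewrite xr andbT (le_lt_trans _ jx) // -[- (2 * rho)]mulrN1 ler_pM2l ?mulr_gt0 //.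
  exact: cos_geN1.
have sp : 0 < sin phi by rewrite sin_gt0_pi // p0.
rewrite -(pmulr_lgt0 _ sp) xE horner_Gpoly_cos mulr_gt0 ?exprn_gt0 //.
have /andP[j0 jpi] := pi_div_itv j.
move: jx; rewrite xE ltr_rhocos ?in_itv /= ?(ltW j0) ?(ltW p0) ?(ltW ppi) //.
rewrite ltr_pdivlMr // mulrC => jp; apply: sin_gt0_pi.
by rewrite jp andbT mulr_gt0.
Qed.

(** The sine formula vanishes at [phi = pi / (j+1)], and [Gpoly_gt0] excludes larger zeros. For
    [j = 0] the angle would be [pi], where the factor [sin phi] is 0. *)
Lemma lamE j : (0 < j)%N -> lam R k j = 2 * rho * cos (pi / j.+1%:R).
Proof.
move=> j0; have /andP[p0 _] := pi_div_itv j.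
have ppi : pi / j.+1%:R < pi :> R.
  by rewrite ltr_pdivrMr // ltr_pMr ?pi_gt0 // ltr1n.
apply: largest_zeroE.
- have := @Gpoly_gt0_ge j (2 * rho) (lexx _).
  by apply: contraTneq => ->; rewrite horner0 ltxx.
- have sp : 0 < sin (pi / j.+1%:R : R) by rewrite sin_gt0_pi // p0.
  have := horner_Gpoly_cos j (pi / j.+1%:R).
  rewrite [_ * (pi / _)]mulrC divfK ?pnatr_eq0 // sinpi mulr0 => /eqP.
  by rewrite mulf_eq0 (gt_eqF sp) orbF.
- move=> y; apply: contraTT; rewrite -ltNge => /Gpoly_gt0.
  by rewrite /root => /gt_eqF->.
Qed.

(** Here [m phi < pi <= (m+1) phi] and [phi < pi], so [(m+1) phi] lies in [[pi, 2 pi)], where the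
    sine is nonpositive. *)
Lemma Gpoly_le0 m x : (0 < m)%N -> 
  2 * rho * cos (pi / m%:R) < x <= 2 * rho * cos (pi / m.+1%:R) -> (G m).[x] <= 0.
Proof.
case: m => // m _ /andP[mx xm]; have r0 := rho_gt0.
have /andP[m0 mpi] := pi_div_itv m; have /andP[m10 m1pi] := pi_div_itv m.+1.
have [|phi /andP[p0 ppi] xE] := @cosP x.
  apply/andP; split.
    rewrite (le_lt_trans _ mx) // -[- (2 * rho)]mulrN1 ler_pM2l ?mulr_gt0 //.
    exact: cos_geN1.
  exact: le_lt_trans xm (rhocos_lt _).
have sp : 0 < sin phi by rewrite sin_gt0_pi // p0.
rewrite -(pmulr_lle0 _ sp) xE horner_Gpoly_cos mulr_ge0_le0 ?exprn_ge0 ?(ltW r0) //.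
move: mx; rewrite xE ltr_rhocos ?in_itv /= ?(ltW m0) ?(ltW p0) ?(ltW ppi) //.
rewrite ltr_pdivlMr // mulrC => mp.
move: xm; rewrite xE leNgt ltr_rhocos ?in_itv /= ?(ltW m10) ?(ltW p0) ?(ltW ppi) //.
rewrite -leNgt ler_pdivrMr // mulrC => pm.
rewrite -[_ * phi](subrK pi) sinDpi oppr_le0 sin_ge0_pi // subr_ge0 pm /=.
have -> : m.+2%:R * phi = m.+1%:R * phi + phi by rewrite -natr1; ring.
lra.
Qed.

Lemma rhocos_le i j : (0 < i <= j)%N ->
  2 * rho * cos (pi / i%:R) <= 2 * rho * cos (pi / j%:R).
Proof.
case: i j => [|i] [|j] //= ij; have /andP[i0 ipi] := pi_div_itv i.
have /andP[j0 jpi] := pi_div_itv j.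
rewrite leNgt ltr_rhocos ?in_itv /= ?(ltW i0) ?(ltW j0) // -leNgt.
by rewrite ler_pM2l ?pi_gt0 // lef_pV2 ?posrE // ler_nat.
Qed.

Lemma bigcup_lam :
  \bigcup_(j in [set j : nat | (1 <= j)%N])
      [set x : R | lam R k j < x <= lam R k j.+1]
  = [set x : R | 0 < x < 2 * rho].
Proof.
have r2 : 0 < 2 * rho by rewrite mulr_gt0 // rho_gt0.
apply/seteqP; split=> x /=.
  move=> [j /= j0 /andP[jx xj]]; rewrite !lamE // in jx xj.
  have /andP[j10 j1pi] := pi_div_itv j.+1.
  apply/andP; split.
    (* The left end of the union is [lambda^(1) = 2 rho cos (pi / 2) = 0]. *)
    apply: le_lt_trans jx; have := @rhocos_le 2 j.+1 j0.
    by rewrite cos_pihalf mulr0.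
  exact: le_lt_trans xj (rhocos_lt _).
move=> /andP[x0 xr]; have [|phi /andP[p0 ppi] xE] := @cosP x.
  by rewrite xr andbT (lt_trans _ x0) // oppr_lt0.
have phi2 : 2%:R * phi < pi.
  move: x0; have -> : 0 = 2 * rho * cos (pi / 2) :> R by rewrite cos_pihalf mulr0.
  have /andP[h0 hpi] := pi_div_itv 1.
  rewrite xE ltr_rhocos ?in_itv /= ?(ltW p0) ?(ltW ppi) ?(ltW h0) //.
  by rewrite ltr_pdivlMr // mulrC.
have exN : exists n, pi <= n%:R * phi.
  exists (Num.truncn (pi / phi)).+1.
  by rewrite -ler_pdivrMr // ltW // truncnS_gt.
(* For the least [n] with [n phi >= pi], the index [j = n - 2] satisfies
   [(j+1) phi < pi <= (j+2) phi]; [2 phi < pi] makes it positive. *)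
case: (ex_minnP exN) => n pin nmin.
have n2 : (2 < n)%N.
  by have := lt_le_trans phi2 pin; rewrite ltr_pM2r // ltr_nat.
case: n n2 pin nmin => [|[|j]] // j0 pin nmin; exists j => //=.
rewrite !lamE // xE.
have /andP[a0 api] := pi_div_itv j; have /andP[b0 bpi] := pi_div_itv j.+1.
rewrite leNgt !ltr_rhocos ?in_itv /= ?(ltW p0) ?(ltW ppi) ?(ltW a0) ?(ltW b0) //.
rewrite -leNgt ler_pdivrMr // ltr_pdivlMr // [phi * j.+2%:R]mulrC pin andbT.
by rewrite ltNge mulrC; apply/negP => /nmin; rewrite ltnn.
Qed.

End LargestZero.

(** * Existence of the maximum, and assembly of the theorem *)

(** The set of orders is nonempty and bounded by the integer part of [M], so it has a greatest
    element. *)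
Lemma exists_is_b (R : realType) (k : nat) (theta M : R) (Gr0 : sgraph) :
  b_class k theta Gr0 ->
  (forall Gr, b_class k theta Gr -> (Defs.order Gr)%:R <= M) ->
  exists n : nat, is_b k theta n /\ n%:R <= M.
Proof.
move=> Gr0b leM.
pose P n := `[< exists Gr, b_class k theta Gr /\ Defs.order Gr = n >].
have exP : exists n, P n by exists (Defs.order Gr0); apply/asboolP; exists Gr0.
have ubP n : P n -> (n <= Num.truncn M)%N.
  move=> /asboolP[Gr [/leM GrM <-]]; rewrite truncn_ge_nat //.
  exact: le_trans GrM.
case: (ex_maxnP exP ubP) => n /asboolP[Gr [Grb Grn]] nmax.
exists n; split; last by rewrite -Grn leM.
by split=> [|Gr' Gr'b]; [exists Gr | apply: nmax; apply/asboolP; exists Gr'].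
Qed.

Theorem theorem4p7 (R : realType) (k : nat) (hk : (2 <= k)%N) :
  \bigcup_(j in [set j : nat | (1 <= j)%N])
      [set x : R | lam R k j < x <= lam R k j.+1]
    = [set x : R | 0 < x < 2 * Num.sqrt (k%:R - 1)]
  /\
  forall (t : nat) (theta : R), (4 <= t)%N ->
    lam R k (t - 3) < theta <= lam R k (t - 2) ->
    let c := - (Fpoly R k (t - 2)).[theta] / (Gpoly R k (t - 4)).[theta] in
    exists n : nat, is_b k theta n /\ n%:R <= Mbound k t c.
Proof.
split=> [|t theta t4 tht c]; first exact: bigcup_lam.
(* The first claim, with [j = t - 3], places [theta] in [(0, 2 rho)], hence below [k]. *)
have : [set x : R | 0 < x < 2 * Num.sqrt (k%:R - 1)] theta.
  rewrite -bigcup_lam //; exists (t - 3)%N => /=; first by rewrite subn_gt0.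
  by rewrite -subSn // ltnW.
move=> /= /andP[th0 thr].
have thk : 0 <= theta < k%:R.
  by rewrite (ltW th0) (lt_le_trans thr) ?rho2_le_degree.
apply: (@exists_is_b _ _ _ _ (complete_bipartite k)).
  by apply: complete_bipartite_b_class (ltW th0); apply: ltnW.
have t3 : (t - 3).+1 = (t - 2)%N by rewrite -subSn // ltnW.
rewrite !lamE ?subn_gt0 // ?t3 in tht; last by rewrite ltnW.
have /andP[tht1 _] := tht.
move=> Gr; apply: b_class_order_le => // [l lt|].
  (* For [l <= t - 4], [2 rho cos (pi / (l+1)) <= lambda^(t-3) < theta]. *)
  apply: Gpoly_gt0 => //; apply: le_lt_trans tht1; apply: rhocos_le => //=.
  by rewrite -t3 ltnS (leq_trans lt) // leq_sub2l.
by apply: Gpoly_le0 => //; rewrite subn_gt0 ltnW.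
Qed.
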